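(* Let $q,z$ be complex numbers with $0<|q|<1$, $z\neq 0$, and $z\ne q^{2m}$ for every nonzero integer $m$. For every integer $k\geq 2$, \begin{align*} &(zq^2, z^{-1}q^2,q^2;q^2)_{\infty}\sum_{n=0}^{\infty}\frac{(q^2;q^2)_{2n}q^{2n}}{(zq^2;q^2)_n(z^{-1}q^2;q^2)_{n}}\\ &\qquad\times\sum_{n_1,\ldots,n_{k-1}=0}^{\infty}\frac{(-1)^{n_{k-1}}q^{2N_1^2+\cdots+2N_{k-2}^2+3N_{k-1}^2+2N_1+\cdots+2N_{k-2}}(q;q^2)_{n_{k-1}}}{(q^2;q^2)_{n-N_1}(q^2;q^2)_{n_1}\cdots(q^2;q^2)_{n_{k-2}}(q^2;q^2)_{2n_{k-1}}}\\ &=\sum_{n=0}^{\infty}\left(\sum_{m=0}^n(-1)^{n}z^{m-n}q^{\frac{1}{2}(2n^2-m^2)+\frac{1}{2}(2n-m)+2(k-1)(m^2+m)}\right.\\ &\qquad\qquad\left.+\sum_{m=1}^n(-1)^{n}z^{n-m+1}q^{\frac{1}{2}(2n^2-m^2)+\frac{1}{2}(2n+m)+2(k-1)(m^2-m)}\right), \end{align*} where $N_j=n_j+n_{j+1}+\cdots+n_{k-1}$ for $1\le j\le k-1$.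
   Context: Notation (used with base $q$ or $q^2$): $(a;q)_\infty=\prod_{n=0}^\infty(1-aq^n)$, $(a;q)_n=\dfrac{(a;q)_\infty}{(aq^n;q)_\infty}$ (so $(a;q)_n=\prod_{i=0}^{n-1}(1-aq^i)$ for $n\ge 0$), and $(a_1,\ldots,a_k;q)_\infty=(a_1;q)_\infty\cdots(a_k;q)_\infty$. Empty sums are $0$. As usual $1/(q^2;q^2)_{n}=0$ for negative integers $n$, so only terms with $N_1\le n$ contribute to the inner multiple sum. When $k=2$, the expressions $2N_1^2+\cdots+2N_{k-2}^2$ and $2N_1+\cdots+2N_{k-2}$ are empty (equal to $0$) and the product $(q^2;q^2)_{n_1}\cdots(q^2;q^2)_{n_{k-2}}$ is empty (equal to $1$). *)

(* Defs.v *)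
From HB Require Import structures.
From mathcomp Require Export all_boot all_order all_algebra.
From mathcomp Require Export complex.
From mathcomp Require Export all_classical all_reals all_analysis.

Set Implicit Arguments.
Unset Strict Implicit.
Unset Printing Implicit Defensive.

Export Order.TTheory GRing.Theory Num.Theory.
Export numFieldNormedType.Exports.

#[global] Open Scope classical_set_scope.
#[global] Open Scope ring_scope.

(* The complex numbers over R, bundled as a numClosedFieldType: the library
   attaches the topology of the norm to the carrier of such a structure, but not
   to the bare type R[i]. *)
Definition Cx (R : realType) : numClosedFieldType := R[i].

Definition qpoch (C : numClosedFieldType) (a q : C) (n : nat) : C :=
  \prod_(0 <= i < n) (1 - a * q ^+ i).

Definition qpoch_inf (C : numClosedFieldType) (a q : C) : C :=
  limn (fun n => qpoch a q n).

(* N_j = n_j + ... + n_(k-1), where the summation indices n_1, ..., n_(k-1)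
   are the values of a : nat -> nat at 1, ..., k-1. *)
Definition tailN (k : nat) (a : nat -> nat) (j : nat) : nat :=
  (\sum_(j <= i < k) a i)%N.

Definition inner_term (C : numClosedFieldType) (q : C) (k n : nat)
    (a : nat -> nat) : C :=
  let N := tailN k a in
  let l := a k.-1 in
  ((-1) ^+ l
   * q ^+ ((\sum_(1 <= j < k.-1) 2 * N j ^ 2) + 3 * N k.-1 ^ 2
           + (\sum_(1 <= j < k.-1) 2 * N j))%N
   * qpoch q (q ^+ 2) l)
  / (qpoch (q ^+ 2) (q ^+ 2) (n - N 1)%N
     * (\prod_(1 <= i < k.-1) qpoch (q ^+ 2) (q ^+ 2) (a i))
     * qpoch (q ^+ 2) (q ^+ 2) (2 * l)%N).

(* The indices n_1, ..., n_(k-1) are the entries of a tuple, shifted by one.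
   Since 1/(q^2;q^2)_(n - N_1) = 0 for N_1 > n, only the tuples with N_1 <= n
   occur, and their entries are at most n. *)
Definition inner_sum (C : numClosedFieldType) (q : C) (k n : nat) : C :=
  \sum_(t : k.-1.-tuple 'I_n.+1 |
          (tailN k (fun i => nth ord0 t i.-1) 1 <= n)%N)
    inner_term q k n (fun i => nth ord0 t i.-1).

Definition lhs_term (C : numClosedFieldType) (q z : C) (k n : nat) : C :=
  qpoch (q ^+ 2) (q ^+ 2) (2 * n)%N * q ^+ (2 * n)%N
  / (qpoch (z * q ^+ 2) (q ^+ 2) n * qpoch (z^-1 * q ^+ 2) (q ^+ 2) n)
  * inner_sum q k n.

(* For m <= n the truncated subtractions in the exponents of q are genuine,
   and the halved quantities 2n^2 - m^2 + 2n -+ m are even. *)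
Definition rhs_term (C : numClosedFieldType) (q z : C) (k n : nat) : C :=
  \sum_(0 <= m < n.+1)
     (-1) ^+ n * z ^ (m%:Z - n%:Z)
     * q ^+ (((2 * n ^ 2 - m ^ 2) + (2 * n - m)) %/ 2
             + 2 * (k - 1) * (m ^ 2 + m))%N
  + \sum_(1 <= m < n.+1)
     (-1) ^+ n * z ^ (n%:Z - m%:Z + 1)
     * q ^+ (((2 * n ^ 2 - m ^ 2) + (2 * n + m)) %/ 2
             + 2 * (k - 1) * (m ^ 2 - m))%N.

(* Main.v *)
(* Put [Q = q^2].  By [k - 1] applications of the Bailey lemma, the multiple sum
   is the second member of a Bailey pair relative to [a = Q] whose first member
   is a signed power of [q] times [1 - Q^(2r+1)]; the seed pair is checked with
   a Wilf-Zeilberger certificate.  It remains to evaluate, for each [r], the sum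
   [S_r] over [n] of
     [(1 - Q^(2r+1)) Q^(r(r-1)/2) (Q;Q)_(2n) Q^n
        / ((zQ;Q)_n (Q/z;Q)_n (Q;Q)_(n-r) (Q;Q)_(n+r+1))].
   The combination [S_(r+2) + S_r + (z + 1/z) S_(r+1)] telescopes in [n], and
   its value at infinity is, up to the theta product [theta], elementary.  The
   partial theta function [sum_(D in Z) (-1)^D z^D Q^T(r+|D|)], with
   [T(n) = n(n+1)/2], satisfies the same inhomogeneous recurrence in [r].  Both
   sequences are [O(Q^(r(r-1)/2))], and the homogeneous recurrence has no nonzero
   solution decaying that fast; so [theta * S_r] is the partial theta function.
   Tannery's theorem justifies exchanging the sums over [n] and [r]. *)
Require Import Defs.
From mathcomp Require Import ring lra zify.

Set Implicit Arguments.
Unset Strict Implicit.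
Unset Printing Implicit Defensive.

(** * Bailey pairs *)

Section QPochhammer.
Variable C : numClosedFieldType.
Implicit Types (a q Q z : C).

Lemma qpoch0 a q : qpoch a q 0 = 1.
Proof. by rewrite /qpoch big_geq. Qed.

Lemma qpochS a q n : qpoch a q n.+1 = qpoch a q n * (1 - a * q ^+ n).
Proof. by rewrite /qpoch big_nat_recr. Qed.

Lemma qpoch_neq0 a q n :
  (forall i, (i < n)%N -> 1 - a * q ^+ i != 0) -> qpoch a q n != 0.
Proof.
elim: n => [|n IH] h; first by rewrite qpoch0 oner_eq0.
by rewrite qpochS mulf_neq0 ?h // IH // => i /ltnW; exact: h.
Qed.

End QPochhammer.

(* [1/(Q;Q)_m = 0] for [m < 0], whereas the truncated [n - r] would give [1]. *)
Definition iqpoch (C : numClosedFieldType) (Q : C) (n r : nat) : C :=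
  if (r <= n)%N then (qpoch Q Q (n - r))^-1 else 0.

Section BaileyPairs.
Variables (C : numClosedFieldType) (Q : C).
Hypothesis Q_neq0 : Q != 0.
Hypothesis Q_aper : forall n, 1 - Q ^+ n.+1 != 0.

Lemma qpochQS n : qpoch Q Q n.+1 = qpoch Q Q n * (1 - Q ^+ n.+1).
Proof. by rewrite qpochS exprS. Qed.

Lemma qpochQ_neq0 n : qpoch Q Q n != 0.
Proof. by apply: qpoch_neq0 => i _; rewrite -exprS. Qed.

Lemma iqpochE n r : (r <= n)%N -> iqpoch Q n r = (qpoch Q Q (n - r))^-1.
Proof. by rewrite /iqpoch => ->. Qed.

Lemma iqpoch_eq0 n r : (n < r)%N -> iqpoch Q n r = 0.
Proof. by rewrite /iqpoch ltnNge => /negPf->. Qed.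

Lemma iqpochSS n r : iqpoch Q n.+1 r.+1 = iqpoch Q n r.
Proof. by rewrite /iqpoch ltnS subSS. Qed.

(** Also true at [r = n.+1], where both sides are 0. The quotient of powers, unlike a truncated
    difference of exponents, lets [field] treat [Q ^+ n] and [Q ^+ r] as independent. *)
Lemma iqpochS n r : (r <= n.+1)%N ->
  iqpoch Q n r = iqpoch Q n.+1 r * (1 - Q ^+ n.+1 / Q ^+ r).
Proof.
move=> rn; rewrite -expfB_cond ?(negPf Q_neq0) //.
move: rn; rewrite leq_eqVlt => /orP[/eqP->|].
  by rewrite iqpoch_eq0 // subnn expr0 subrr mulr0.
rewrite ltnS => rn; rewrite !iqpochE ?(leqW rn) // subSn // qpochQS.
by rewrite invfM -mulrA mulVf ?mulr1 // Q_aper.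
Qed.

(* Writing [1 - Q^M = (1 - Q^(M-s)) + Q^(M-s) (1 - Q^s)], the left-hand side
   [f M c] satisfies [(1 - Q^M) f M c = f (M-1) c + Q^(M+c) f (M-1) (c+1)]. *)
Lemma q_vandermonde M c :
  \sum_(0 <= s < M.+1) Q ^+ (s * (s + c)) /
     (qpoch Q Q s * qpoch Q Q (s + c)) * iqpoch Q M s
  = (qpoch Q Q M * qpoch Q Q (M + c))^-1.
Proof.
elim: M c => [|M IH] c.
  by rewrite big_nat1 iqpochE // !qpoch0 add0n mul0n expr0 !mul1r invr1 mulr1.
apply: (mulfI (Q_aper M)); rewrite big_distrr /=.
pose f N c s := Q ^+ (s * (s + c)) /
     (qpoch Q Q s * qpoch Q Q (s + c)) * iqpoch Q N s.
have split_s s : (0 <= s < M.+2)%N -> (1 - Q ^+ M.+1) * f M.+1 c s =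
    f M c s + Q ^+ M.+1 * (Q ^- s - 1) * f M.+1 c s.
  move=> /andP[_ sM]; rewrite /f (@iqpochS M) //.
  by set v := Q ^+ M.+1; field; rewrite expf_neq0 // !qpochQ_neq0.
(* The first sum loses its last term, where [iqpoch] is 0, the second its first, where
   [Q ^- 0 - 1 = 0]; shifting [s] in the latter turns [c] into [c.+1]. *)
rewrite (eq_big_nat _ _ split_s) big_split /= [X in X + _]big_nat_recr //=.
rewrite [X in _ + X]big_nat_recl //= {2}/f iqpoch_eq0 // mulr0 addr0 IH.
rewrite expr0 invr1 subrr mulr0 mul0r add0r.
rewrite (eq_bigr (fun s => Q ^+ (M.+1 + c) * f M c.+1 s)); last first.
  move=> s _; rewrite /f iqpochSS addSnnS !qpochQS.
  have -> : (s.+1 * (s + c.+1) = s * (s + c.+1) + s.+1 + c)%N by lia.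
  rewrite 3!exprD.
  have := Q_aper s; set v := Q ^+ s.+1 => v1.
  by field; rewrite v1 expf_neq0 // !qpochQ_neq0.
rewrite -big_distrr /= IH addSnnS !qpochQS !addnS qpochQS -addSn.
have := Q_aper M; have := Q_aper (M + c); rewrite -addSn.
by set v := Q ^+ (_ + _); set w := Q ^+ _ => v1 w1; field;
  rewrite v1 w1 !qpochQ_neq0.
Qed.

Lemma iqpochSr n r : iqpoch Q n r.+1 = iqpoch Q n r * (1 - Q ^+ n / Q ^+ r).
Proof.
have [nr|rn] := ltnP n r; first by rewrite !iqpoch_eq0 ?mul0r // ltnW.
have := @iqpochS n r.+1; rewrite iqpochSS ltnS => ->//; congr (_ * (1 - _)).
by rewrite !exprS invfM mulrACA divff // mul1r.
Qed.

(** Only [l >= r] contributes, and [l = r + s] gives [q_vandermonde] with [M = n - r] and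
    [c = 2r + 1]. *)
Lemma bailey_kernel n r :
  \sum_(0 <= l < n.+1)
     Q ^+ (l * l.+1) * iqpoch Q n l * (iqpoch Q l r / qpoch Q Q (l + r).+1)
  = Q ^+ (r * r.+1) * (iqpoch Q n r / qpoch Q Q (n + r).+1).
Proof.
have [nr|rn] := ltnP n r.
  rewrite [iqpoch Q n r]iqpoch_eq0 // mul0r mulr0 big_nat big1 // => l /andP[_ ln].
  by rewrite [iqpoch Q l r]iqpoch_eq0 ?mul0r ?mulr0 // (leq_trans ln).
rewrite (@big_cat_nat _ _ _ r) ?leqW //= [X in X + _]big_nat big1 ?add0r; last first.
  by move=> l /andP[_ lr]; rewrite [iqpoch Q l r]iqpoch_eq0 ?mul0r ?mulr0.
rewrite -{1}[r]add0n big_addn subSn //.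
pose M := (n - r)%N; have nE : n = (r + M)%N by rewrite subnKC.
rewrite -/M (eq_bigr (fun s => Q ^+ (r * r.+1) * (Q ^+ (s * (s + r.*2.+1)) /
     (qpoch Q Q s * qpoch Q Q (s + r.*2.+1)) * iqpoch Q M s))); last first.
  move=> s _; rewrite (@iqpochE _ r) ?leq_addl // addnK.
  have -> : iqpoch Q n (s + r) = iqpoch Q M s.
    by rewrite /iqpoch nE addnC leq_add2l subnDl.
  have -> : ((s + r) * (s + r).+1 = r * r.+1 + s * (s + r.*2.+1))%N by lia.
  have -> : (s + r + r).+1 = (s + r.*2.+1)%N by lia.
  by rewrite exprD invfM; ring.
rewrite -big_distrr /= q_vandermonde iqpochE // -/M invfM.
by congr (_ * (_ / qpoch Q Q _)); lia.
Qed.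

(* Relative to [a = Q], where [(aQ;Q)_(n+r) = (Q;Q)_(n+r+1) / (1 - Q)]; the
   factor [1 - Q] is absorbed into the first member [A]. *)
Definition bailey_mate (A : nat -> C) (n : nat) : C :=
  \sum_(0 <= r < n.+1) A r * (iqpoch Q n r / qpoch Q Q (n + r).+1).

Lemma bailey_mate_wide A n N : (n < N)%N ->
  bailey_mate A n =
  \sum_(0 <= r < N) A r * (iqpoch Q n r / qpoch Q Q (n + r).+1).
Proof.
move=> nN; rewrite (@big_cat_nat _ _ _ n.+1 0 N) //= [X in _ + X]big_nat.
rewrite [X in _ + X]big1 ?addr0 // => r /andP[nr _].
by rewrite iqpoch_eq0 // mul0r mulr0.
Qed.

(** The case [a = Q] of Bailey's lemma with both free parameters sent to infinity; once the sums are
    exchanged it is [bailey_kernel] for each [r]. *)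
Lemma bailey_lemma A n :
  \sum_(0 <= l < n.+1) Q ^+ (l * l.+1) * iqpoch Q n l * bailey_mate A l
  = bailey_mate (fun r => Q ^+ (r * r.+1) * A r) n.
Proof.
under eq_big_nat => l /andP[_ ln].
  rewrite (@bailey_mate_wide _ _ n.+1) // big_distrr /=.
  under eq_bigr do rewrite mulrCA.
  over.
rewrite exchange_big_nat /=; apply: eq_bigr => r _.
by rewrite -big_distrr /= bailey_kernel mulrA [A r * _]mulrC.
Qed.

(** * The telescoping recurrence behind the conjugate Bailey pair *)

Section ConjugatePair.
Variable z : C.
Hypothesis z_neq0 : z != 0.
Hypothesis zQ_neq1 : forall i, 1 - z * Q ^+ i.+1 != 0.
Hypothesis zVQ_neq1 : forall i, 1 - z^-1 * Q ^+ i.+1 != 0.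

Definition conj_fac n : C :=
  qpoch Q Q (2 * n) / (qpoch (z * Q) Q n * qpoch (z^-1 * Q) Q n).

(* The factors depending on [r] only are chosen so that [conj_term_rec] and
   [ptheta_rec] are the same recurrence. *)
Definition conj_term n r : C :=
  (1 - Q ^+ r.*2.+1) * Q ^+ 'C(r, 2) *
  (conj_fac n * Q ^+ n * (iqpoch Q n r / qpoch Q Q (n + r).+1)).

(** The antidifference in [n] for [conj_term_rec]. For [n > 0] the two linear factors cancel the
    last factors in the denominator of [conj_fac n]. *)
Definition conj_bdry n r : C :=
  (1 - Q ^+ r.*2.+1) * Q ^+ 'C(r, 2) *
  (conj_fac n * ((1 - z * Q ^+ n) * (1 - z^-1 * Q ^+ n)) *
   (iqpoch Q n r / qpoch Q Q (n + r).+1)).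

Lemma conj_facS n :
  conj_fac n.+1 = conj_fac n * ((1 - Q ^+ n.*2.+1) * (1 - Q ^+ n.*2.+2)) /
     ((1 - z * Q ^+ n.+1) * (1 - z^-1 * Q ^+ n.+1)).
Proof.
rewrite /conj_fac mulnS !qpochQS (qpochS (z * Q)) (qpochS (z^-1 * Q)).
rewrite mul2n -!mulrA -!exprS !invfM; ring.
Qed.

Lemma conj_term_rec n r :
  conj_term n r.+2 + conj_term n r + (z + z^-1) * conj_term n r.+1
  = conj_bdry n.+1 r.+1 - conj_bdry n r.+1.
Proof.
rewrite /conj_term /conj_bdry conj_facS iqpochSS !iqpochSr !addnS !addSn.
rewrite !qpochQS.
rewrite !binS !bin1 !bin0.
have hz := zQ_neq1 n; have hzV := zVQ_neq1 n.
have := Q_aper (n + r); have := Q_aper (n + r).+1; have := Q_aper (n + r).+2.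
rewrite !doubleS.
rewrite -!muln2 !exprS !exprD !exprM in hz hzV *.
have xn0 : Q ^+ n != 0 by rewrite expf_neq0.
have yn0 : Q ^+ r != 0 by rewrite expf_neq0.
have := qpochQ_neq0 (n + r).
move: (Q ^+ n) (Q ^+ r) xn0 yn0 hz hzV => x y x0 y0 hz hzV.
move: (qpoch _ _ _) => p p0 h1 h2 h3.
field.
(* [field] clears [z^-1], so [1 - z^-1 * Q ^+ n.+1] reappears multiplied by [z]. *)
have hzV' : z - Q * x != 0.
  have -> : z - Q * x = z * (1 - z^-1 * (Q * x)) by field.
  by rewrite mulf_neq0.
by rewrite p0 h1 h2 h3 hz hzV' y0 z_neq0 Q_neq0.
Qed.

Lemma sum_conj_term_rec N r :
  \sum_(0 <= n < N) conj_term n r.+2 + \sum_(0 <= n < N) conj_term n r +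
  (z + z^-1) * \sum_(0 <= n < N) conj_term n r.+1 = conj_bdry N r.+1.
Proof.
rewrite big_distrr -!big_split /= (eq_bigr _ (fun n _ => conj_term_rec n r)).
(* The lower boundary value contains [iqpoch Q 0 r.+1 = 0]. *)
rewrite telescope_sumr // [conj_bdry 0 _]/conj_bdry iqpoch_eq0 //.
by rewrite mul0r !mulr0 subr0.
Qed.

End ConjugatePair.
End BaileyPairs.

(** * The seed Bailey pair *)

Section InitialPair.
Variables (C : numClosedFieldType) (q : C).
Local Notation Q := (q ^+ 2).
Hypothesis q_neq0 : q != 0.
Hypothesis q_aper : forall n, 1 - q ^+ n.+1 != 0.

Let Q_neq0 : Q != 0. Proof. by rewrite expf_neq0. Qed.
Let Q_aper n : 1 - Q ^+ n.+1 != 0.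
Proof. by rewrite -exprM mulnS add2n. Qed.

(** The exponent ['C(r.+1, 2) - 2r] is negative at [r = 1] and [r = 2], hence the quotient of
    powers. *)
Definition alpha0 (r : nat) : C :=
  (-1) ^+ r * q ^+ 'C(r.+1, 2) / q ^+ r.*2 * (1 - Q ^+ r.*2.+1).

(** As [3l^2 = 2l(l+1) + l^2 - 2l], the summand of the inner sum for [k = 2] is
    [Q ^+ (l * l.+1) * iqpoch Q n l * beta0 l]. *)
Definition beta0 (l : nat) : C :=
  (-1) ^+ l * q ^+ (l * l) / q ^+ l.*2 * qpoch q Q l / qpoch Q Q l.*2.

(* The certificate of a Wilf-Zeilberger pair for the sum [bailey_mate alpha0]. *)
Let cert l r : C := let x := q ^+ l in let y := q ^+ r in
  (-1 + y / q - y ^+ 2 / q + y ^+ 3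
   + x ^+ 2 * (- q / y - q ^+ 2 * y + q ^+ 2 * y ^+ 2 + q * y ^+ 4))
  * ((-1) ^+ r * q ^+ 'C(r.+1, 2) / q ^+ r.*2)
  * (iqpoch Q l.+1 r / qpoch Q Q (l + r).+1).

(** The leading coefficient of the first-order recurrence in [l] that both [bailey_mate Q alpha0]
    and [beta0] satisfy. *)
Let lead l : C := (1 + q ^+ l.*2.+1) * (1 - (q ^+ l) ^+ 4 * q ^+ 4).

Let cert_step l r : (r <= l.+1)%N ->
  lead l * (alpha0 r * (iqpoch Q l.+1 r / qpoch Q Q (l.+1 + r).+1))
  + q ^+ l.*2 / q * (alpha0 r * (iqpoch Q l r / qpoch Q Q (l + r).+1))
  = cert l r.+1 - cert l r.
Proof.
move=> rl; rewrite /lead /alpha0 /cert iqpochSS // [iqpoch _ l r]iqpochS //.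
rewrite !addSn !addnS !qpochQS [in X in _ = X]binS bin1 exprD.
have := Q_aper (l + r); have := Q_aper (l + r).+1.
have := qpochQ_neq0 Q_aper (l + r); move: (qpoch Q Q (l + r)) => p p0.
have qD n : q ^+ n.*2 = q ^+ n ^+ 2 by rewrite -muln2 exprM.
have QE n : Q ^+ n = q ^+ n ^+ 2 by rewrite -!exprM mulnC.
rewrite !doubleS !QE ![q ^+ _.+1]exprS ![(-1) ^+ _.+1]exprS !qD exprD.
have x0 : q ^+ l != 0 by rewrite expf_neq0.
have y0 : q ^+ r != 0 by rewrite expf_neq0.
move: (q ^+ l) (q ^+ r) x0 y0 => x y x0 y0 h1 h2; field.
by rewrite p0 h1 h2 q_neq0 y0.
Qed.

Lemma bailey_mate_alpha0 l : bailey_mate Q alpha0 l = beta0 l.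
Proof.
elim: l => [|l IH].
  rewrite /bailey_mate big_nat1 /alpha0 /beta0 iqpochE // subnn.
  rewrite !qpochS !qpoch0.
  have := q_aper 1; rewrite !expr0 !expr1 !mulr1 !divr1 => h; by field.
(* Summed over [r <= l.+1], the certificate telescopes to 0: [iqpoch Q l.+1 l.+2 = 0], and the first
   factor of [cert] vanishes at [q ^+ r = 1]. *)
have step : lead l * bailey_mate Q alpha0 l.+1
    + q ^+ l.*2 / q * bailey_mate Q alpha0 l = 0.
  rewrite [bailey_mate _ _ l](@bailey_mate_wide _ _ _ _ l.+2) // /bailey_mate.
  rewrite !big_distrr -big_split /=.
  rewrite (eq_big_nat _ _ (F2 := fun r => cert l r.+1 - cert l r)); last first.
    by move=> r /andP[_ rl]; exact: cert_step.
  rewrite telescope_sumr // /cert [iqpoch _ _ l.+2]iqpoch_eq0 // !expr0.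
  by rewrite !mul0r mulr0 sub0r !expr1n !divr1; ring.
have := q_aper l.*2; have := Q_aper l.*2; have := Q_aper l.*2.+1.
move: step; rewrite IH; move: (bailey_mate Q alpha0 l.+1) => S.
rewrite /lead /beta0 doubleS !qpochQS !qpochS.
have qD n : q ^+ n.*2 = q ^+ n ^+ 2 by rewrite -muln2 exprM.
have QE n : Q ^+ n = q ^+ n ^+ 2 by rewrite -!exprM mulnC.
have := qpochQ_neq0 Q_aper l.*2; move: (qpoch Q Q l.*2) => p p0.
have x0 : q ^+ l != 0 by rewrite expf_neq0.
have -> : (l.+1 * l.+1 = l * l + l.*2 + 1)%N by lia.
rewrite !QE ![q ^+ l.*2.+2]exprS ![q ^+ l.*2.+1]exprS [(-1) ^+ l.+1]exprS !qD !exprD qD.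
move: (q ^+ l) x0 => x x0 step h1 h2 h3.
(* The first factor divides [1 - Q ^+ l.*2.+1]; the second is [1 - Q ^+ l.*2.+2]. *)
have lead0 : (1 + q * x ^+ 2) * (1 - x ^+ 4 * q ^+ 4) != 0.
  rewrite mulf_neq0 //; last by apply: contraNneq h1 => <-; apply/eqP; ring.
  by apply: contraNneq h2 => h; rewrite -(expr1n _ 2) subr_sqr h mulr0.
apply: (mulfI lead0); move/eqP: step; rewrite addr_eq0 => /eqP e.
by rewrite e; field; rewrite h1 h2 p0 x0.
Qed.
End InitialPair.

(** * The multiple sum *)

Section SimplexSums.
Variable V : nmodType.

Lemma big_tuple_cons (T : finType) m (P : pred (seq T)) (F : seq T -> V) :
  \sum_(t : m.+1.-tuple T | P t) F t
  = \sum_(x : T) \sum_(t : m.-tuple T | P (x :: t)) F (x :: t).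
Proof.
rewrite pair_big_dep /=.
rewrite (reindex (fun p : T * m.-tuple T => cons_tuple p.1 p.2)) //=.
exists (fun t : m.+1.-tuple T => (thead t, behead_tuple t)) => [[x t]|t] _ /=.
  by congr pair; apply: val_inj.
by apply: val_inj; case/tupleP: t.
Qed.

(* The sum of [F] over the [m]-tuples of naturals of sum at most [n], in a form
   that does not depend on a common bound for the entries. *)
Fixpoint simplex_sum m n (F : seq nat -> V) : V :=
  if m is m'.+1 then
    \sum_(0 <= i < n.+1) simplex_sum m' (n - i)%N (fun s => F (i :: s))
  else F [::].

Lemma simplex_sumS m n F : simplex_sum m.+1 n F =
  \sum_(0 <= i < n.+1) simplex_sum m (n - i)%N (fun s => F (i :: s)).
Proof. by []. Qed.

Lemma eq_simplex_sum m n F F' :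
  (forall s, size s = m -> (sumn s <= n)%N -> F s = F' s) ->
  simplex_sum m n F = simplex_sum m n F'.
Proof.
elim: m n F F' => [|m IH] n F F' FF' /=; first exact: FF'.
apply: eq_big_nat => i; rewrite ltnS => /= lin; apply: IH => s ss sn.
by apply: FF' => /=; [rewrite ss | lia].
Qed.

(** An entry above [n] already breaks the condition, so every bound [B >= n] works; sums over
    different simplices can thus share one type of tuples. *)
Lemma tuple_simplex_sum B m n F : (n <= B)%N ->
  \sum_(t : m.-tuple 'I_B.+1 | (sumn (map val t) <= n)%N) F (map val t)
  = simplex_sum m n F.
Proof.
elim: m n F => [|m IH] n F nB.
  rewrite (big_pred1 [tuple]) //= => t; rewrite [t]tuple0 /=.
  by rewrite eqxx.
rewrite (@big_tuple_cons _ _ (fun s => sumn (map val s) <= n)%N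
  (fun s => F (map val s))) /=.
rewrite -(big_mkord xpredT (fun i => \sum_(t : m.-tuple 'I_B.+1 |
   (i + sumn (map val t) <= n)%N) F (i :: map val t))).
rewrite (@big_cat_nat _ _ _ n.+1) //= [X in _ + X]big_nat [X in _ + X]big1.
  rewrite addr0; apply: eq_big_nat => i /= lin.
  rewrite -(IH (n - i)%N) ?(leq_trans (leq_subr _ _)) //.
  by apply: eq_bigl => t; rewrite leq_subRL.
move=> i /andP[ni _]; rewrite big_pred0 // => t.
by apply/negbTE; rewrite -ltnNge (leq_trans ni) // leq_addr.
Qed.

(** The substitution [l = i + sumn s]: over tuples with the common bound [n] the sums can be
    exchanged, and for fixed [s] only the range of [i] is shifted. *)
Lemma simplex_sum_shift m n (F : nat -> seq nat -> V) :
  \sum_(0 <= i < n.+1) simplex_sum m (n - i)%N (F i)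
  = \sum_(0 <= l < n.+1) simplex_sum m l (fun s => F (l - sumn s)%N s).
Proof.
under eq_big_nat => i ?.
  rewrite -(@tuple_simplex_sum n) ?leq_subr //; over.
under [RHS]eq_big_nat => l /= ln.
  rewrite -(@tuple_simplex_sum n) //; over.
rewrite (exchange_big_dep xpredT) //= [RHS](exchange_big_dep xpredT) //=.
apply: eq_bigr => t _; move: (sumn _) => S.
have [nS|Sn] := ltnP n S.
  rewrite big_nat_cond big_pred0 => [|i]; last by apply/negbTE; lia.
  by rewrite big_nat_cond big_pred0 // => i; apply/negbTE; lia.
transitivity (\sum_(0 <= i < n.+1 - S) F i (map val t)).
  rewrite [RHS](@big_nat_widen _ _ _ _ _ n.+1) ?leq_subr //.
  by rewrite big_nat_cond [RHS]big_nat_cond; apply: eq_bigl => i; lia.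
rewrite -(big_nat_widenl S 0 n.+1 xpredT (fun l => F (l - S)%N (map val t))) //.
rewrite -{2}[S]add0n big_addn.
by apply: eq_bigr => i _; rewrite addnK.
Qed.
End SimplexSums.

Section MultiSum.
Variables (C : numClosedFieldType) (q : C).
Local Notation Q := (q ^+ 2).
Hypothesis q_neq0 : q != 0.
Hypothesis q_aper : forall n, 1 - q ^+ n.+1 != 0.

Let seq_term k n (s : seq nat) : C := inner_term q k n (fun i => nth 0%N s i.-1).

Lemma inner_sum_simplex m n :
  inner_sum q m.+1 n = simplex_sum m n (seq_term m.+1 n).
Proof.
rewrite -(@tuple_simplex_sum _ n m) // /inner_sum /=.
have nthE (t : m.-tuple 'I_n.+1) : (fun i => nth ord0 t i.-1 : nat) =
    (fun i => nth 0%N (map val t) i.-1).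
  apply: funext => i; have [it|ti] := ltnP i.-1 (size t).
    by rewrite (nth_map ord0).
  by rewrite !nth_default ?size_map.
apply: eq_big => t; rewrite nthE // /tailN big_add1 /=.
by rewrite [in RHS]sumnE [in RHS](big_nth 0%N) size_map size_tuple.
Qed.

(** Here [i = n_1] and [i + sumn s = N_1]. Reading [(Q;Q)_(n_1)] as [(Q;Q)_(N_1 - N_2)] leaves the
    summand for [k - 1] with [n] replaced by [N_1]. *)
Lemma seq_term_cons m n i s : size s = m.+1 -> (i + sumn s <= n)%N ->
  seq_term m.+3 n (i :: s) =
  Q ^+ ((i + sumn s) * (i + sumn s).+1) * iqpoch Q n (i + sumn s) *
  seq_term m.+2 (i + sumn s)%N s.
Proof.
move=> ss sn; rewrite /seq_term /inner_term /=.
have tN j : tailN m.+3 (fun i0 => nth 0%N (i :: s) i0.-1) j.+2 =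
   tailN m.+2 (fun i0 => nth 0%N s i0.-1) j.+1.
  by rewrite /tailN big_add1; apply: eq_big_nat => -[|l] //=; rewrite ltnNge.
have s1 : tailN m.+2 (fun i0 => nth 0%N s i0.-1) 1 = sumn s.
  by rewrite /tailN big_add1 [in RHS]sumnE [in RHS](big_nth 0%N) ss.
have s2 : tailN m.+3 (fun i0 => nth 0%N (i :: s) i0.-1) 1 = (i + sumn s)%N.
  by rewrite -s1 -tN /tailN big_ltn.
rewrite !s1 s2 tN iqpochE // !big_add1 /= ![in LHS]big_nat_recl //= addnK s2.
under [in LHS]eq_bigr do rewrite tN.
under [X in (_ + (_ + X))%N]eq_bigr do rewrite tN.
move: (\sum_(0 <= i0 < m) _)%N (tailN _ _ m.+1) => A B.
move: (\sum_(0 <= i0 < m) _)%N (\prod_(0 <= i0 < m) _) => D P.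
move: (i + sumn s)%N => N.
have -> : (2 * N ^ 2 + A + 3 * B ^ 2 + (2 * N + D) =
   2 * (N * N.+1) + (A + 3 * B ^ 2 + D))%N by lia.
by rewrite exprD exprM !invfM; ring.
Qed.

Lemma inner_sum_rec m n :
  inner_sum q m.+3 n =
  \sum_(0 <= l < n.+1) Q ^+ (l * l.+1) * iqpoch Q n l * inner_sum q m.+2 l.
Proof.
rewrite inner_sum_simplex simplex_sumS.
transitivity (\sum_(0 <= i < n.+1) simplex_sum m.+1 (n - i)%N (fun s =>
  Q ^+ ((i + sumn s) * (i + sumn s).+1) * iqpoch Q n (i + sumn s) *
  seq_term m.+2 (i + sumn s)%N s)).
  apply: eq_big_nat => i ni; apply: eq_simplex_sum => s ss sn.
  by apply: seq_term_cons => //; rewrite -leq_subRL; case/andP: ni.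
rewrite (simplex_sum_shift m.+1 _ (fun i s =>
  Q ^+ ((i + sumn s) * (i + sumn s).+1) * iqpoch Q n (i + sumn s) *
  seq_term m.+2 (i + sumn s)%N s)).
apply: eq_big_nat => l ln.
rewrite inner_sum_simplex -!(@tuple_simplex_sum _ l m.+1) // big_distrr /=.
by apply: eq_bigr => t tl; rewrite subnK.
Qed.

(** For [k = m.+2] the seed pair passes [m.+1] times through [bailey_lemma]: once in the base case
    and once for each use of [inner_sum_rec]. *)
Lemma inner_sum_bailey m n :
  inner_sum q m.+2 n =
  bailey_mate Q (fun r => Q ^+ (m.+1 * (r * r.+1)) * alpha0 q r) n.
Proof.
have Q_neq0 : Q != 0 by rewrite expf_neq0.
have Q_aper i : 1 - Q ^+ i.+1 != 0 by rewrite -exprM mulnS add2n.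
elim: m n => [|m IH] n; last first.
  rewrite inner_sum_rec.
  under eq_bigr do rewrite IH.
  rewrite bailey_lemma //; congr (bailey_mate Q _ n); apply: funext => r.
  by rewrite mulrA -exprD -mulSn.
have -> : (fun r => Q ^+ (1 * (r * r.+1)) * alpha0 q r) =
    (fun r => Q ^+ (r * r.+1) * alpha0 q r).
  by apply: funext => r; rewrite mul1n.
rewrite -bailey_lemma // inner_sum_simplex /=.
apply: eq_big_nat => l /= ln.
rewrite bailey_mate_alpha0 // /seq_term /inner_term /beta0 /=.
rewrite !big_geq // /tailN big_nat1 /= iqpochE // add0n addn0 mulr1.
rewrite -mul2n.
have -> : (3 * l ^ 2 = 2 * (l * l.+1) + l * l - 2 * l)%N by lia.
rewrite expfB_cond; last by rewrite (negPf q_neq0); lia.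
by rewrite exprD exprM !invfM; ring.
Qed.

End MultiSum.

(** * Series and products of complex numbers *)

Section ComplexLimits.
Variable R : realType.
Local Notation C := (Cx R).
Implicit Types (x y : C) (u v : nat -> C).

(* The library norm of [Cx R] is valued in [Cx R] itself. *)
Definition cabs (x : C) : R := ComplexField.Normc.normc (x : R[i]).

Lemma cabsE x : `|x| = (cabs x)%:C%C :> C.
Proof. by case: x. Qed.

Lemma cabs_ge0 x : 0 <= cabs x.
Proof. by case: x => a b; rewrite /cabs /= sqrtr_ge0. Qed.

Lemma cabsM x y : cabs (x * y) = cabs x * cabs y.
Proof. exact: ComplexField.Normc.normcM. Qed.

Lemma cabsD x y : cabs (x + y) <= cabs x + cabs y.
Proof. exact: le_normcD. Qed.

Lemma cabsN x : cabs (- x) = cabs x.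
Proof. exact: normcN. Qed.

Lemma cabs0 : cabs 0 = 0.
Proof. exact: ComplexField.Normc.normc0. Qed.

Lemma cabs1 : cabs 1 = 1.
Proof. exact: ComplexField.Normc.normc1. Qed.

Lemma cabsX x n : cabs (x ^+ n) = cabs x ^+ n.
Proof. by elim: n => [|n IH]; rewrite ?expr0 ?cabs1 // !exprS cabsM IH. Qed.

Lemma cabsB x y : cabs (x - y) = cabs (y - x).
Proof. by rewrite -cabsN opprB. Qed.

Lemma cabs_gt0 x : (0 < cabs x) = (x != 0).
Proof. by rewrite -ltcR -cabsE normr_gt0. Qed.

Lemma cabs_sum (I : Type) (r : seq I) (P : pred I) (F : I -> C) :
  cabs (\sum_(i <- r | P i) F i) <= \sum_(i <- r | P i) cabs (F i).
Proof.
elim/big_ind2 : _ => [|x y s t xy st|//]; first by rewrite cabs0.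
by apply: (le_trans (cabsD _ _)); exact: lerD.
Qed.

Lemma cvg_cabsP u (l : C) :
  u @ \oo --> l <-> (fun n => cabs (u n - l)) @ \oo --> (0 : R).
Proof.
split=> [/cvgrPdist_lt ul|/cvgrPdist_lt ul].
  apply/cvgrPdist_lt => e e0; have := ul (e%:C)%C.
  rewrite ltcR => /(_ e0); apply: filterS => n.
  by rewrite cabsE ltcR sub0r normrN ger0_norm ?cabs_ge0 // cabsB.
apply/(@cvgrPdist_lt C C) => e e0.
(* The radius is an element of [Cx R], but a positive one is real. *)
have eE : e = (complex.Re e)%:C%C by rewrite RRe_real // gtr0_real.
have := ul (complex.Re e); rewrite -ltcR -eE => /(_ e0); apply: filterS => n.
by rewrite sub0r normrN ger0_norm ?cabs_ge0 // cabsE {2}eE ltcR cabsB.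
Qed.

Lemma cvgC_unique u (a b : C) : u @ \oo --> a -> u @ \oo --> b -> a = b.
Proof. by move=> ua ub; apply: cvg_unique ua ub; exact: norm_hausdorff. Qed.

Lemma cvg_cabs_le u (l : C) (B : R) : u @ \oo --> l ->
  (forall n, cabs (u n) <= B) -> cabs l <= B.
Proof.
move=> ul uB; apply/ler_addgt0Pr => e e0.
have /cvg_cabsP/cvgrPdist_lt/(_ e e0)[N _ /(_ N (leqnn N))] := ul.
rewrite /= sub0r normrN ger0_norm ?cabs_ge0 // cabsB => lte.
rewrite -[l](subrK (u N)) addrC.
apply: le_trans (cabsD _ _) _; apply: lerD => //; exact: ltW.
Qed.

Lemma Re_le_cabs x : `|complex.Re x| <= cabs x.
Proof.
by case: x => a b; rewrite /cabs /= -sqrtr_sqr ler_wsqrtr // lerDl sqr_ge0.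
Qed.

Lemma Im_le_cabs x : `|complex.Im x| <= cabs x.
Proof.
by case: x => a b; rewrite /cabs /= -sqrtr_sqr ler_wsqrtr // lerDr sqr_ge0.
Qed.

Lemma cabs_le_ReIm x : cabs x <= `|complex.Re x| + `|complex.Im x|.
Proof.
case: x => a b; rewrite /cabs /= -[leRHS]ger0_norm ?addr_ge0 // -sqrtr_sqr.
by rewrite ler_wsqrtr // sqrrD !real_normK ?num_real // lerD2r lerDl mulrn_wge0 // mulr_ge0.
Qed.

Lemma real_series_geo_cvg (f : nat -> R) (K rho : R) : 0 <= rho < 1 ->
  (forall n, `|f n| <= K * rho ^+ n) -> cvgn (series f).
Proof.
move=> /andP[r0 r1] fK; apply: normed_cvg.
apply: (@series_le_cvg _ _ (geometric K rho)) => //.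
- by move=> n; rewrite /= normr_ge0.
- by move=> n; apply: le_trans (fK n); rewrite normr_ge0.
- by apply: is_cvg_geometric_series; rewrite ger0_norm.
Qed.

(** The real and imaginary parts converge by comparison with a real geometric series. *)
Lemma series_geo_cvg u (K rho : R) : 0 <= rho < 1 ->
  (forall n, cabs (u n) <= K * rho ^+ n) -> cvgn (series u).
Proof.
move=> r01 uK.
have cRe : cvgn (series (fun n => complex.Re (u n))).
  apply: (@real_series_geo_cvg _ K rho r01) => n.
  by apply: le_trans (uK n); exact: Re_le_cabs.
have cIm : cvgn (series (fun n => complex.Im (u n))).
  apply: (@real_series_geo_cvg _ K rho r01) => n.
  by apply: le_trans (uK n); exact: Im_le_cabs.
pose l : C := Complex (limn (series (fun n => complex.Re (u n))))
  (limn (series (fun n => complex.Im (u n)))).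
suff : series u @ \oo --> l by move=> /cvgP.
apply/cvg_cabsP.
move/cvgrPdist_lt : cRe => cRe; move/cvgrPdist_lt: cIm => cIm.
apply/cvgrPdist_lt => e e0.
near=> n.
rewrite sub0r normrN ger0_norm ?cabs_ge0 //; apply: le_lt_trans (cabs_le_ReIm _) _.
have ReS : complex.Re (series u n) = series (fun n => complex.Re (u n)) n.
  rewrite /series /=.
  by rewrite (big_morph (fun x : R[i] => complex.Re x) (id1 := 0)
    (op1 := +%R)) // => -[? ?] [].
have ImS : complex.Im (series u n) = series (fun n => complex.Im (u n)) n.
  rewrite /series /=.
  by rewrite (big_morph (fun x : R[i] => complex.Im x) (id1 := 0)
    (op1 := +%R)) // => -[? ?] [].
have -> x y : complex.Re (x - y : C) = complex.Re x - complex.Re y by case: x; case: y.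
have -> x y : complex.Im (x - y : C) = complex.Im x - complex.Im y by case: x; case: y.
rewrite ReS ImS /= [e]splitr ltrD // distrC.
  by near: n; apply: cRe; rewrite divr_gt0.
by near: n; apply: cIm; rewrite divr_gt0.
Unshelve. all: by end_near. Qed.

Lemma cvg_cabs_bounded u (l : C) : u @ \oo --> l ->
  exists2 B : R, 0 < B & forall n, cabs (u n) <= B.
Proof.
move=> /cvg_cabsP/cvgrPdist_lt /(_ 1 ltr01) [N _ uN].
exists (1 + cabs l + \sum_(0 <= n < N) cabs (u n)).
  by rewrite ltr_pwDl // ?sumr_ge0 // => [|i _]; rewrite ?ltr_pwDl ?cabs_ge0.
move=> n; have [Nn|nN] := leqP N n.
  rewrite -[u n](subrK l); apply: le_trans (cabsD _ _) _.
  rewrite -[leLHS]addr0 lerD ?sumr_ge0 // => [|i _]; last exact: cabs_ge0.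
  rewrite lerD2r; have := uN n Nn.
  by rewrite /= sub0r normrN ger0_norm ?cabs_ge0 // => /ltW.
rewrite -[leLHS]add0r lerD ?addr_ge0 ?cabs_ge0 //.
rewrite (bigD1_seq n) ?iota_uniq ?mem_index_iota //= lerDl sumr_ge0 // => i _.
exact: cabs_ge0.
Qed.

End ComplexLimits.

Section Tannery.
Variable R : realType.
Local Notation C := (Cx R).

Lemma sum_geo_le (rho : R) m n : 0 <= rho < 1 ->
  \sum_(m <= r < n) rho ^+ r <= rho ^+ m / (1 - rho).
Proof.
move=> /andP[r0 r1]; have r1' : 0 < 1 - rho by rewrite subr_gt0.
rewrite ler_pdivlMr //.
have [mn|/ltnW nm] := leqP m n; last by rewrite big_geq // mul0r exprn_ge0.
elim: n mn => [|n IH] mn; first by rewrite big_geq // mul0r exprn_ge0.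
suff -> : (\sum_(m <= r < n.+1) rho ^+ r) * (1 - rho) = rho ^+ m - rho ^+ n.+1.
  by rewrite gerBl exprn_ge0.
elim: n mn {IH} => [|n IH] mn.
  case: m mn => [|[|m]] // _; first by rewrite big_nat1 expr0 mul1r.
  by rewrite big_geq // mul0r subrr.
move: mn; rewrite leq_eqVlt => /orP[/eqP->|mn]; first by rewrite big_geq // mul0r subrr.
by rewrite big_nat_recr //= mulrDl IH // ![rho ^+ _.+1]exprS; ring.
Qed.

(** The difference from the limit is split at an index [M]: the later terms are at most
    [2 * K * rho ^+ r] and sum to less than [e / 2], while the first [M] terms tend to 0 one by
    one. *)
Lemma tannery (a : nat -> nat -> C) (b : nat -> C) (K rho : R) :
  0 <= rho < 1 ->
  (forall N r, cabs (a N r) <= K * rho ^+ r) ->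
  (forall r, a ^~ r @ \oo --> b r) ->
  (fun N => \sum_(0 <= r < N) a N r) @ \oo --> limn (series b).
Proof.
move=> r01 aK ab.
have bK r : cabs (b r) <= K * rho ^+ r := cvg_cabs_le (ab r) (aK ^~ r).
have K0 : 0 <= K.
  by have := le_trans (cabs_ge0 _) (aK 0%N 0%N); rewrite expr0 mulr1.
have cb : cvgn (series b) := series_geo_cvg r01 bK.
suff : (fun N => \sum_(0 <= r < N) (a N r - b r)) @ \oo --> (0 : C).
  move=> d; rewrite -[limn _]add0r.
  rewrite (_ : (fun N => _) = (fun N => \sum_(0 <= r < N) (a N r - b r)) \+ series b).
    exact: (cvgD d cb).
  by apply/funext => N /=; rewrite /series /= -big_split /=; apply: eq_bigr => r _; rewrite subrK.
apply/cvg_cabsP/cvgrPdist_lt => e e0.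
have : (fun M => rho ^+ M * (2 * K / (1 - rho))) @ \oo --> (0 : R).
  rewrite -[0](mul0r (2 * K / (1 - rho))); apply: cvgMl.
  by apply: cvg_expr; rewrite ger0_norm; case/andP: r01.
move=> /cvgrPdist_lt/(_ (e / 2)) []; first by rewrite divr_gt0.
move=> M _ /(_ M (leqnn M)); rewrite /= sub0r normrN => /(le_lt_trans (ler_norm _)) tailM.
have headM : (fun N => \sum_(0 <= r < M) cabs (a N r - b r)) @ \oo --> (0 : R).
  elim: M {tailM} => [|M IH].
    by under eq_fun do rewrite big_geq //; exact: cvg_cst.
  rewrite (_ : (fun N => _) = (fun N => \sum_(0 <= r < M) cabs (a N r - b r)) \+
    (fun N => cabs (a N M - b M))).
    rewrite -[X in _ --> X]addr0.
    exact: (cvgD IH (iffLR (cvg_cabsP _ _) (ab M))).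
  by apply/funext => N; rewrite big_nat_recr.
move/cvgrPdist_lt: headM => headM.
near=> N.
have MN : (M <= N)%N by near: N; exact: nbhs_infty_ge.
rewrite sub0r normrN ger0_norm ?cabs_ge0 // subr0.
rewrite (@big_cat_nat _ _ _ M) //=; apply: le_lt_trans (cabsD _ _) _.
rewrite [e]splitr; apply: ltrD.
  apply: le_lt_trans (cabs_sum _ _ _) _; apply: le_lt_trans (ler_norm _) _.
  rewrite -normrN -sub0r; near: N; apply: headM; by rewrite divr_gt0.
apply: le_lt_trans tailM; apply: le_trans (cabs_sum _ _ _) _.
rewrite mulrC mulrAC -mulrA.
apply: (@le_trans _ _ (2 * K * \sum_(M <= r < N) rho ^+ r)); last first.
  by rewrite ler_wpM2l ?sum_geo_le // mulr_ge0.
rewrite big_distrr /=; apply: ler_sum => r _.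
apply: le_trans (cabsD _ _) _; rewrite cabsN -mulrA mulr_natl mulr2n.
by rewrite lerD.
Unshelve. all: by end_near. Qed.
End Tannery.

Section Products.
Variable R : realType.
Local Notation C := (Cx R).

(** As [P n.+1 - P n = u n * P n], the product is 1 plus a series, which is geometrically dominated
    because [1 + x <= expR x] bounds [P]. *)
Lemma prod_geo_cvg (u : nat -> C) (K rho : R) : 0 <= rho < 1 ->
  (forall n, cabs (u n) <= K * rho ^+ n) ->
  cvgn (fun n => \prod_(0 <= i < n) (1 + u i)).
Proof.
move=> r01 uK; pose P n := \prod_(0 <= i < n) (1 + u i).
have K0 : 0 <= K.
  by have := le_trans (cabs_ge0 _) (uK 0%N); rewrite expr0 mulr1.
have PB n : cabs (P n) <= expR (K / (1 - rho)).
  apply: (@le_trans _ _ (expR (\sum_(0 <= i < n) K * rho ^+ i))); last first.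
    by rewrite ler_expR -big_distrr /= ler_wpM2l // -[leRHS]mul1r -(expr0 rho) sum_geo_le.
  elim: n => [|n IH]; first by rewrite /P !big_geq // cabs1 expR0.
  rewrite /P !big_nat_recr //= cabsM expRD ler_pM ?cabs_ge0 //.
  apply: le_trans (expR_ge1Dx _); apply: le_trans (cabsD _ _) _.
  by rewrite cabs1 lerD2l.
have PE : P = (fun n => 1 + series (fun n => u n * P n) n).
  apply/funext; elim=> [|n IH]; first by rewrite /P /series /= !big_geq // addr0.
  rewrite seriesEnat /= big_nat_recr //= addrA -IH.
  by rewrite /P big_nat_recr //= mulrDr mulr1 mulrC.
have cS : cvgn (series (fun n => u n * P n)).
  apply: (@series_geo_cvg _ _ (K * expR (K / (1 - rho))) rho) => // n.
  by rewrite cabsM mulrAC ler_pM ?cabs_ge0.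
have aux (F G : nat -> C) (l : C) : F = G -> G @ \oo --> l -> cvgn F.
  by move=> -> h; apply/cvg_ex; exists l.
exact: (aux _ _ _ PE (cvgD (cvg_cst (1 : C)) cS)).
Qed.

(* The quotients [K * rho ^+ n] of successive terms eventually drop below 1. *)
Lemma superexp_bounded (K rho : R) : 0 <= K -> 0 <= rho < 1 ->
  exists2 B, 0 <= B & forall n, K ^+ n * rho ^+ 'C(n, 2) <= B.
Proof.
move=> K0 /andP[r0 r1].
have : (fun M => rho ^+ M * K) @ \oo --> (0 : R).
  rewrite -[0](mul0r K); apply: cvgMl.
  by apply: cvg_expr; rewrite ger0_norm.
move=> /cvgrPdist_lt/(_ 1 ltr01) [M _ Mle].
have K1 : 1 <= 1 + K by rewrite lerDl.
(* Only the first [M] quotients can exceed 1, and each is at most [K]. *)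
exists ((1 + K) ^+ M); first by rewrite exprn_ge0 // (le_trans ler01).
move=> n; apply: (@le_trans _ _ ((1 + K) ^+ minn n M)); last first.
  by rewrite ler_weXn2l // geq_minr.
elim: n => [|n IH]; first by rewrite !expr0 mulr1 min0n expr0.
rewrite exprSr binS bin1 exprD mulrACA.
have rn1 : 0 <= K * rho ^+ n by rewrite mulr_ge0 ?exprn_ge0.
have [Mn|nM] := leqP M n.
  rewrite (minn_idPr (leqW Mn)) -(minn_idPr Mn) -[leRHS]mulr1.
  rewrite ler_pM ?mulr_ge0 ?exprn_ge0 // mulrC.
  have := Mle n Mn; rewrite /= sub0r normrN => /(le_lt_trans (ler_norm _)).
  exact: ltW.
rewrite (minn_idPl nM) exprSr; rewrite (minn_idPl (ltnW nM)) in IH.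
rewrite ler_pM ?mulr_ge0 ?exprn_ge0 //.
by rewrite (le_trans (_ : _ <= K * 1)) ?ler_wpM2l ?exprn_ile1 // ?mulr1 ?lerDr // ltW.
Qed.

End Products.

Section QPochLimits.
Variable R : realType.
Local Notation C := (Cx R).
Implicit Types (a Q : C) (u : nat -> C).

Lemma series_geo_bounded u (K rho : R) : 0 <= rho < 1 ->
  (forall n, cabs (u n) <= K * rho ^+ n) ->
  forall n, cabs (series u n) <= K / (1 - rho).
Proof.
move=> r01 uK n; apply: le_trans (cabs_sum _ _ _) _.
have K0 : 0 <= K by have := le_trans (cabs_ge0 _) (uK 0%N); rewrite expr0 mulr1.
apply: (@le_trans _ _ (\sum_(0 <= i < n) K * rho ^+ i)); first exact: ler_sum.
by rewrite -big_distrr ler_wpM2l // -[leRHS]mul1r -(expr0 rho) sum_geo_le.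
Qed.

Lemma cvg_cabsX Q : cabs Q < 1 -> (fun n => Q ^+ n) @ \oo --> (0 : C).
Proof.
move=> Q1; apply/cvg_cabsP.
rewrite (_ : (fun n => _) = (fun n => cabs Q ^+ n)).
  by apply: cvg_expr; rewrite ger0_norm // cabs_ge0.
by apply/funext => n; rewrite subr0 cabsX.
Qed.

Lemma qpoch_cvg a Q : cabs Q < 1 -> cvgn (qpoch a Q).
Proof.
move=> Q1.
rewrite (_ : qpoch a Q = fun n => \prod_(0 <= i < n) (1 + - (a * Q ^+ i))) //.
apply: (@prod_geo_cvg _ _ (cabs a) (cabs Q)); first by rewrite cabs_ge0.
by move=> n; rewrite cabsN cabsM cabsX.
Qed.

(** [1 / (1 - x) = 1 + x / (1 - x)], and the factors [1 / (1 - a * Q ^+ i)] are bounded since they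
    tend to 1; so [prod_geo_cvg] applies again. *)
Lemma qpochV_cvg a Q : cabs Q < 1 -> (forall i, 1 - a * Q ^+ i != 0) ->
  cvgn (fun n => (qpoch a Q n)^-1).
Proof.
move=> Q1 aQ.
have [B B0 hB] : exists2 B : R, 0 < B & forall i, cabs (1 - a * Q ^+ i)^-1 <= B.
  apply: (@cvg_cabs_bounded _ _ (1 - a * 0)^-1); apply: cvgV.
    by rewrite mulr0 subr0 oner_neq0.
  exact: (cvgB (cvg_cst (1 : C)) (cvgM (cvg_cst a) (cvg_cabsX Q1))).
rewrite (_ : (fun n => _) =
  fun n => \prod_(0 <= i < n) (1 + a * Q ^+ i * (1 - a * Q ^+ i)^-1)).
  apply: (@prod_geo_cvg _ _ (cabs a * B) (cabs Q)); first by rewrite cabs_ge0.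
  by move=> n; rewrite !cabsM cabsX mulrAC ler_pM ?mulr_ge0 ?exprn_ge0 ?cabs_ge0 // ler_pM ?cabs_ge0.
apply/funext => n; rewrite /qpoch -prodfV; apply: eq_bigr => i _.
by have h := aQ i; field.
Qed.

(** The partial products and their inverses both converge, and their limits multiply to 1. *)
Lemma qpoch_inf_neq0 a Q : cabs Q < 1 -> (forall i, 1 - a * Q ^+ i != 0) ->
  qpoch_inf a Q != 0.
Proof.
move=> Q1 aQ; apply/eqP => h0.
have : qpoch a Q \* (fun n => (qpoch a Q n)^-1) @ \oo -->
    qpoch_inf a Q * limn (fun n => (qpoch a Q n)^-1).
  exact: (cvgM (qpoch_cvg (a := a) Q1) (qpochV_cvg Q1 aQ)).
have -> : qpoch a Q \* (fun n => (qpoch a Q n)^-1) = fun=> 1.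
  by apply/funext => n /=; rewrite divff // qpoch_neq0.
rewrite h0 mul0r => /cvgC_unique /(_ (cvg_cst (1 : C))) /eqP.
by rewrite eq_sym oner_eq0.
Qed.

Lemma qpochV_inf a Q : cabs Q < 1 -> (forall i, 1 - a * Q ^+ i != 0) ->
  (fun n => (qpoch a Q n)^-1) @ \oo --> (qpoch_inf a Q)^-1.
Proof.
move=> Q1 aQ; apply: cvgV; first exact: qpoch_inf_neq0.
exact: qpoch_cvg.
Qed.

End QPochLimits.

(** * The conjugate Bailey pair and partial theta functions *)

Lemma bin2D m n : ('C(m + n, 2) = 'C(m, 2) + 'C(n, 2) + m * n)%N.
Proof.
elim: n => [|n IH]; first by rewrite (@bin_small 0 2) // muln0 !addn0.
by rewrite addnS !binS !bin1 IH; lia.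
Qed.

Lemma leq_ptheta_exponent r d :
  ('C(d, 2) + 'C(r, 2) + d <= 'C((r + d).+1, 2))%N.
Proof. by rewrite [leqRHS]binS bin1 bin2D; lia. Qed.

Section ThreeTermRecurrence.
Variable R : realType.
Local Notation C := (Cx R).

(* Running the recurrence backwards loses a bounded factor [K] at each step,
   which the superexponential decay outweighs. *)
Lemma three_term_eq0 (d : nat -> C) (w : C) (B rho : R) :
  0 <= rho < 1 -> (forall r, cabs (d r) <= B * rho ^+ 'C(r, 2)) ->
  (forall r, d r.+2 + d r + w * d r.+1 = 0) -> forall r, d r = 0.
Proof.
move=> /[dup] r01 /andP[r0 r1] dB rec r.
have B0 : 0 <= B.
  by have := le_trans (cabs_ge0 _) (dB 0%N); rewrite bin_small // expr0 mulr1.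
pose K : R := cabs w + 1; have K0 : 0 <= K by rewrite addr_ge0 ?cabs_ge0.
(* The bound after [s] backward steps; [d r.+2] obeys the bound for [d r.+1], as [rho ^+ 'C(r, 2)]
   decreases in [r]. *)
have bound s : forall r, cabs (d r) <= K ^+ s * (B * rho ^+ 'C(r + s, 2)).
  elim: s => [|s IH] {}r; first by rewrite expr0 mul1r addn0.
  have -> : d r = - (w * d r.+1) - d r.+2.
    by apply/eqP; rewrite -subr_eq0 -(rec r); apply/eqP; ring.
  apply: le_trans (cabsD _ _) _; rewrite !cabsN cabsM.
  rewrite exprS -mulrA {1}/K mulrDl mul1r -addSnnS.
  apply: lerD; first by rewrite ler_wpM2l ?cabs_ge0.
  apply: le_trans (IH _) _; rewrite ler_wpM2l ?exprn_ge0 // ler_wpM2l //.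
  by rewrite ler_wiXn2l ?(ltW r1) // leq_bin2l // !addSn.
(* Taking [2 * K] instead of [K] leaves a factor [2^-1 ^+ s] to spare. *)
have [B' B'0 hB'] := superexp_bounded (mulr_ge0 (ltW (ltr0Sn R 1)) K0) r01.
have small s : cabs (d r) <= 2^-1 ^+ s * (B * B').
  apply: le_trans (bound s r) _; rewrite mulrCA [leRHS]mulrCA ler_wpM2l //.
  rewrite exprVn [leRHS]mulrC ler_pdivlMr ?exprn_gt0 // mulrAC -exprMn [K * 2]mulrC.
  apply: le_trans (hB' s); rewrite ler_wpM2l ?exprn_ge0 ?mulr_ge0 //.
  by rewrite ler_wiXn2l ?(ltW r1) // leq_bin2l // leq_addl.
apply/eqP; apply: contraT; rewrite -cabs_gt0 => dr0.
have : (fun n => 2^-1 ^+ n * (B * B')) @ \oo --> (0 : R).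
  rewrite -[0](mul0r (B * B')); apply: cvgMl.
  by apply: cvg_expr; rewrite ger0_norm ?invr_ge0 // invf_lt1 // ltr1n.
move=> /cvgrPdist_lt/(_ _ dr0) [N _ /(_ N (leqnn N))].
rewrite /= sub0r normrN => /(le_lt_trans (ler_norm _)).
by rewrite ltNge small.
Qed.

End ThreeTermRecurrence.

Section ConjLimits.
Variables (R : realType).
Local Notation C := (Cx R).
Variables (Q z : C).
Hypothesis Q_neq0 : Q != 0.
Hypothesis Q_lt1 : cabs Q < 1.
Hypothesis z_neq0 : z != 0.
Hypothesis zQ_neq1 : forall i, 1 - z * Q ^+ i.+1 != 0.
Hypothesis zVQ_neq1 : forall i, 1 - z^-1 * Q ^+ i.+1 != 0.

Let rho := cabs Q.
Let rho01 : 0 <= rho < 1. Proof. by rewrite cabs_ge0. Qed.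

Lemma expr_aper n : 1 - Q ^+ n.+1 != 0.
Proof.
rewrite subr_eq0; apply/eqP => /(congr1 (@cabs R)); rewrite cabs1 cabsX => e.
by have := exprn_ilt1 n.+1 (cabs_ge0 Q) Q_lt1; rewrite -e ltxx.
Qed.

Let QQ_neq1 i : 1 - Q * Q ^+ i != 0. Proof. by rewrite -exprS expr_aper. Qed.
Let zQQ_neq1 i : 1 - z * Q * Q ^+ i != 0. Proof. by rewrite -mulrA -exprS. Qed.
Let zVQQ_neq1 i : 1 - z^-1 * Q * Q ^+ i != 0. Proof. by rewrite -mulrA -exprS. Qed.

(** Jacobi's triple product without its factor [1 - z], hence nonzero also at [z = 1]. *)
Definition theta := qpoch_inf (z * Q) Q * qpoch_inf (z^-1 * Q) Q * qpoch_inf Q Q.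

Lemma theta_neq0 : theta != 0.
Proof. by rewrite !mulf_neq0 ?qpoch_inf_neq0. Qed.

Lemma conj_fac_cvg : conj_fac Q z @ \oo -->
  qpoch_inf Q Q / (qpoch_inf (z * Q) Q * qpoch_inf (z^-1 * Q) Q).
Proof.
rewrite /conj_fac; apply: cvgM.
  apply: (cvg_comp (fun n => (2 * n)%N) (qpoch Q Q)) => /=; last exact: qpoch_cvg.
  by move=> A [N _ NA]; exists N => // n Nn; apply: NA; exact: leq_trans Nn (leq_pmull _ _).
apply: cvgV; first by rewrite mulf_neq0 ?qpoch_inf_neq0.
by apply: cvgM; exact: qpoch_cvg.
Qed.

Lemma iqpoch_cvg r : (iqpoch Q)^~ r @ \oo --> (qpoch_inf Q Q)^-1.
Proof.
rewrite -(cvg_shiftn r).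
rewrite (_ : (fun n => _) = (fun n => (qpoch Q Q n)^-1)); first exact: qpochV_inf.
by apply/funext => n; rewrite /= iqpochE ?leq_addl // addnK.
Qed.

(** One limit of [qpoch Q Q] in the numerator and two in the denominator leave the one that
    completes [theta]. *)
Lemma conj_bdry_cvg r : conj_bdry Q z ^~ r @ \oo -->
  (1 - Q ^+ r.*2.+1) * Q ^+ 'C(r, 2) / theta.
Proof.
have qinv : (fun n => (qpoch Q Q (n + r).+1)^-1) @ \oo --> (qpoch_inf Q Q)^-1.
  have := qpochV_inf Q_lt1 QQ_neq1; rewrite -(cvg_shiftn r.+1).
  by under eq_fun do rewrite addnS.
have lin a : (fun n => 1 - a * Q ^+ n) @ \oo --> (1 : C).
  rewrite -[X in _ --> X]subr0 -(mulr0 a).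
  exact: (cvgB (cvg_cst (1 : C)) (cvgM (cvg_cst a) (cvg_cabsX Q_lt1))).
have -> : (1 - Q ^+ r.*2.+1) * Q ^+ 'C(r, 2) / theta =
  (1 - Q ^+ r.*2.+1) * Q ^+ 'C(r, 2) *
  (qpoch_inf Q Q / (qpoch_inf (z * Q) Q * qpoch_inf (z^-1 * Q) Q) * (1 * 1) *
   ((qpoch_inf Q Q)^-1 * (qpoch_inf Q Q)^-1)).
  by rewrite /theta; field; rewrite !qpoch_inf_neq0.
exact: (cvgM (cvg_cst ((1 - Q ^+ r.*2.+1) * Q ^+ 'C(r, 2)))
  (cvgM (cvgM conj_fac_cvg (cvgM (lin z) (lin z^-1))) (cvgM (iqpoch_cvg r) qinv))).
Qed.

(** Uniform in both indices: [rho ^+ n] makes the sum over [n] converge, and [rho ^+ 'C(r, 2)] is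
    the decay that [three_term_eq0] asks for. *)
Lemma conj_term_bounded : exists2 B : R, 0 <= B &
  forall n r, cabs (conj_term Q z n r) <= B * rho ^+ 'C(r, 2) * rho ^+ n.
Proof.
have [B1 B10 hB1] := cvg_cabs_bounded conj_fac_cvg.
have [B2 B20 hB2] := cvg_cabs_bounded (qpochV_inf Q_lt1 QQ_neq1).
exists (2 * (B1 * (B2 * B2))) => [|n r]; first by rewrite !mulr_ge0 ?ltW.
have iqB : cabs (iqpoch Q n r) <= B2.
  by rewrite /iqpoch; case: ifP => _; rewrite ?cabs0 ?hB2 // ltW.
have oneB : cabs (1 - Q ^+ r.*2.+1) <= 2.
  apply: le_trans (cabsD _ _) _; rewrite cabs1 cabsN cabsX -[leRHS]/(1 + 1) lerD2l.
  by rewrite exprn_ile1 ?cabs_ge0 // ltW.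
have := hB1 n; rewrite /conj_term; move: (conj_fac Q z n) => c hc.
rewrite !cabsM !cabsX -/rho.
rewrite [leRHS](_ : _ = 2 * rho ^+ 'C(r, 2) * (B1 * rho ^+ n * (B2 * B2))); last by ring.
have r0 m : 0 <= rho ^+ m by rewrite exprn_ge0 ?cabs_ge0.
by rewrite !ler_pM ?mulr_ge0 ?cabs_ge0 ?hB2.
Qed.

Definition conj_sum r : C := limn (series (conj_term Q z ^~ r)).

Lemma conj_sum_cvg r : cvgn (series (conj_term Q z ^~ r)).
Proof.
have [B _ hB] := conj_term_bounded.
exact: (series_geo_cvg rho01 (hB ^~ r)).
Qed.

Lemma conj_sum_rec r :
  conj_sum r.+2 + conj_sum r + (z + z^-1) * conj_sum r.+1
  = (1 - Q ^+ r.*2.+3) * Q ^+ 'C(r.+1, 2) / theta.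
Proof.
apply: (@cvgC_unique _ (conj_bdry Q z ^~ r.+1)); last first.
  by rewrite -doubleS; exact: conj_bdry_cvg.
rewrite (_ : conj_bdry Q z ^~ r.+1 =
  (series (conj_term Q z ^~ r.+2) \+ series (conj_term Q z ^~ r)) \+
  (fun=> z + z^-1) \* series (conj_term Q z ^~ r.+1)).
  exact: (cvgD (cvgD (@conj_sum_cvg r.+2) (@conj_sum_cvg r))
    (cvgM (cvg_cst (z + z^-1)) (@conj_sum_cvg r.+1))).
by apply/funext => N; rewrite /= -sum_conj_term_rec //; exact: expr_aper.
Qed.

(* The terms of [sum_(D in Z) (-1)^D z^D Q^T(r+|D|)], with those of index [D]
   and [-D] grouped, and [T(n) = 'C(n.+1, 2)]. *)
Definition ptheta_term r D : C :=
  if D is 0%N then Q ^+ 'C(r.+1, 2)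
  else (-1) ^+ D * (z ^+ D + z^-1 ^+ D) * Q ^+ 'C((r + D).+1, 2).

(** By [leq_ptheta_exponent] a factor [rho ^+ 'C(D, 2)] is left over, which absorbs the growth of
    [z ^+ D] and [z^-1 ^+ D]. *)
Lemma ptheta_term_bounded : exists2 B : R, 0 <= B &
  forall r D, cabs (ptheta_term r D) <= B * rho ^+ 'C(r, 2) * rho ^+ D.
Proof.
pose M := cabs z + cabs z^-1.
have M0 : 0 <= M by rewrite addr_ge0 ?cabs_ge0.
have [B B0 hB] := superexp_bounded M0 rho01.
have r0 m : 0 <= rho ^+ m by rewrite exprn_ge0 ?cabs_ge0.
have rho1 := ltW Q_lt1.
have rho_le m n : (n <= m)%N -> rho ^+ m <= rho ^+ n.
  by move=> nm; rewrite ler_wiXn2l ?cabs_ge0.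
exists (1 + 2 * B) => [|r D]; first by rewrite addr_ge0 ?mulr_ge0.
case: D => [|D]; rewrite /ptheta_term.
  rewrite cabsX expr0 mulr1 -[leLHS]mul1r ler_pM // ?lerDl ?mulr_ge0 //.
  by rewrite rho_le // leq_bin2l.
rewrite !cabsM !cabsX cabsN cabs1 expr1n mul1r.
have zM : cabs (z ^+ D.+1 + z^-1 ^+ D.+1) <= 2 * M ^+ D.+1.
  apply: le_trans (cabsD _ _) _; rewrite mulr_natl mulr2n !cabsX.
  by apply: lerD; rewrite lerXn2r ?nnegrE ?cabs_ge0 // ?lerDl ?lerDr cabs_ge0.
apply: (@le_trans _ _ (2 * M ^+ D.+1 * (rho ^+ 'C(D.+1, 2) * rho ^+ 'C(r, 2) * rho ^+ D.+1))).
  rewrite ler_pM ?cabs_ge0 // -!exprD rho_le //.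
  exact: leq_ptheta_exponent.
have := hB D.+1 => h.
rewrite [leLHS](_ : _ = 2 * (M ^+ D.+1 * rho ^+ 'C(D.+1, 2)) * (rho ^+ 'C(r, 2) * rho ^+ D.+1)); last by ring.
rewrite -[leRHS]mulrA ler_wpM2r ?mulr_ge0 //.
by apply: (@le_trans _ _ (2 * B)); rewrite ?ler_wpM2l // lerDr.
Qed.

Definition ptheta r : C := limn (series (ptheta_term r)).

Lemma ptheta_cvg r : cvgn (series (ptheta_term r)).
Proof.
have [B _ hB] := ptheta_term_bounded.
exact: (series_geo_cvg rho01 (hB r)).
Qed.

(** Multiplication by [z + z^-1] moves [D] by one either way, and [T(r+1+|D-1|)], [T(r+1+|D+1|)] are
    [T(r+|D|)], [T(r+2+|D|)] in some order for [D] nonzero. So only [D = 0] and the cut-off at [M]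
    leave terms. *)
Let ptheta_partial r M :
  series (ptheta_term r.+2) M.+1 + series (ptheta_term r) M.+1
    + (z + z^-1) * series (ptheta_term r.+1) M.+1
  = (1 - Q ^+ r.*2.+3) * Q ^+ 'C(r.+1, 2)
    + ((-1) ^+ M * (z ^+ M + z^-1 ^+ M) * Q ^+ 'C((r + M).+3, 2)
       - ptheta_term r M.+1).
Proof.
rewrite !seriesEnat /=.
elim: M => [|M IH].
  rewrite !big_nat1 /ptheta_term !expr0 !expr1 addn0 addn1.
  have -> : Q ^+ 'C(r.+3, 2) = Q ^+ r.*2.+3 * Q ^+ 'C(r.+1, 2).
    by rewrite -exprD; congr (_ ^+ _); rewrite binS bin1 binS bin1; lia.
  ring.
rewrite !(@big_nat_recr _ _ _ M.+1) //=; move: IH.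
move: (\sum_(0 <= k < M.+1) ptheta_term r.+2 k)
  (\sum_(0 <= k < M.+1) ptheta_term r k)
  (\sum_(0 <= k < M.+1) ptheta_term r.+1 k) => a b c IH.
transitivity ((1 - Q ^+ r.*2.+3) * Q ^+ 'C(r.+1, 2)
    + ((-1) ^+ M * (z ^+ M + z^-1 ^+ M) * Q ^+ 'C((r + M).+3, 2)
       - ptheta_term r M.+1) + ptheta_term r.+2 M.+1 + ptheta_term r M.+1
   + (z + z^-1) * ptheta_term r.+1 M.+1); first by rewrite -IH /ptheta_term; ring.
by rewrite /ptheta_term !addSn !addnS !exprS; field.
Qed.

Lemma ptheta_term_cvg0 r : ptheta_term r @ \oo --> (0 : C).
Proof.
have [B B0 hB] := ptheta_term_bounded.
apply/cvg_cabsP.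
apply: (@squeeze_cvgr _ _ _ _ (fun=> 0) (fun n => rho ^+ n * (B * rho ^+ 'C(r, 2)))).
- by apply: nearW => n; rewrite subr0 cabs_ge0 mulrC hB.
- exact: cvg_cst.
- rewrite -[X in _ --> X](mul0r (B * rho ^+ 'C(r, 2))); apply: cvgMl.
  by apply: cvg_expr; rewrite ger0_norm ?cabs_ge0.
Qed.

Lemma ptheta_rec r :
  ptheta r.+2 + ptheta r + (z + z^-1) * ptheta r.+1
  = (1 - Q ^+ r.*2.+3) * Q ^+ 'C(r.+1, 2).
Proof.
(* The value of [ptheta_partial] at [M = n.+1]. At [M = 0] its cut-off term would be twice
   [ptheta_term r.+2 0]. *)
pose u (n : nat) : C := (1 - Q ^+ r.*2.+3) * Q ^+ 'C(r.+1, 2)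
    + (ptheta_term r.+2 n.+1 - ptheta_term r n.+2).
have shift t k : (fun n => series (ptheta_term t) (n + k)%N) @ \oo --> ptheta t.
  by rewrite (cvg_shiftn k); exact: ptheta_cvg.
have shift0 t k : (fun n => ptheta_term t (n + k)%N) @ \oo --> (0 : C).
  by rewrite (cvg_shiftn k); exact: ptheta_term_cvg0.
apply: (@cvgC_unique _ u); last first.
  rewrite -[X in _ --> X]addr0 -[X in _ --> _ + X]subr0.
  rewrite (_ : u = fun n => (1 - Q ^+ r.*2.+3) * Q ^+ 'C(r.+1, 2)
    + (ptheta_term r.+2 (n + 1)%N - ptheta_term r (n + 2)%N)); last first.
    by apply/funext => n; rewrite addn1 addn2.
  exact: (cvgD (cvg_cst ((1 - Q ^+ r.*2.+3) * Q ^+ 'C(r.+1, 2)))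
    (cvgB (@shift0 r.+2 1%N) (@shift0 r 2%N))).
rewrite (_ : u = fun n => series (ptheta_term r.+2) (n + 2)%N + series (ptheta_term r) (n + 2)%N
    + (z + z^-1) * series (ptheta_term r.+1) (n + 2)%N).
  exact: (cvgD (cvgD (@shift r.+2 2%N) (@shift r 2%N))
    (cvgM (cvg_cst (z + z^-1)) (@shift r.+1 2%N))).
by apply/funext => n; rewrite addn2 ptheta_partial /u /ptheta_term !addSn !addnS.
Qed.

Lemma theta_conj_sum r : theta * conj_sum r = ptheta r.
Proof.
have [B B0 hB] := conj_term_bounded; have [B' B'0 hB'] := ptheta_term_bounded.
apply/eqP; rewrite -subr_eq0; apply/eqP; move: r.
apply: (@three_term_eq0 _ _ (z + z^-1)
  (cabs theta * (B / (1 - rho)) + B' / (1 - rho)) rho) => // r; last first.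
  move: (conj_sum_rec r) (ptheta_rec r) theta_neq0; move: theta.
  move: (conj_sum r) (conj_sum r.+1) (conj_sum r.+2).
  move: (ptheta r) (ptheta r.+1) (ptheta r.+2) => A B1 A2 a b c t h1 h2 t0.
  transitivity (t * (c + a + (z + z^-1) * b) - (A2 + A + (z + z^-1) * B1)).
    ring.
  by rewrite h1 h2 mulrC divfK ?subrr.
apply: le_trans (cabsD _ _) _; rewrite cabsN cabsM mulrDl -mulrA.
apply: lerD; rewrite ?ler_wpM2l ?cabs_ge0 // mulrAC.
  exact: (cvg_cabs_le (@conj_sum_cvg r) (series_geo_bounded rho01 (hB ^~ r))).
exact: (cvg_cabs_le (@ptheta_cvg r) (series_geo_bounded rho01 (hB' r))).
Qed.

End ConjLimits.

(** * Assembling the two sides *)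

Lemma bin2_double n : ('C(n.+1, 2) * 2)%N = (n * n.+1)%N.
Proof. by elim: n => // n IH; rewrite binS bin1 mulnDl IH; lia. Qed.

Section Terms.
Variables (R : realType).
Local Notation C := (Cx R).
Variables (q z : C).
Local Notation Q := (q ^+ 2).
Hypothesis q_neq0 : q != 0.
Hypothesis q_aper : forall n, 1 - q ^+ n.+1 != 0.
Hypothesis z_neq0 : z != 0.

(* For [k = m + 2], the first member [Q^((k-1)r(r+1)) alpha0 r] of the pair
   divided by [(1 - Q^(2r+1)) Q^(r(r-1)/2)]. *)
Definition mate_coef m r : C := (-1) ^+ r * q ^+ ((4 * m + 3) * 'C(r.+1, 2)).

Lemma lhs_termE m n : lhs_term q z m.+2 n =
  \sum_(0 <= r < n.+1) mate_coef m r * conj_term Q z n r.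
Proof.
rewrite /lhs_term inner_sum_bailey // /bailey_mate big_distrr /=.
apply: eq_bigr => r _; rewrite /conj_term /conj_fac /alpha0 /mate_coef.
rewrite [q ^+ (2 * n)]exprM.
have -> : (-1) ^+ r * q ^+ ((4 * m + 3) * 'C(r.+1, 2)) =
  Q ^+ (m.+1 * (r * r.+1)) * ((-1) ^+ r * q ^+ 'C(r.+1, 2) / q ^+ r.*2) / Q ^+ 'C(r, 2).
  have -> : ((4 * m + 3) * 'C(r.+1, 2) =
     2 * (m.+1 * (r * r.+1)) + 'C(r.+1, 2) - (r.*2 + 2 * 'C(r, 2)))%N.
    by rewrite -bin2_double binS bin1; lia.
  rewrite expfB_cond; last first.
    by rewrite (negPf q_neq0) -bin2_double binS bin1; lia.
  have qE a b : q ^+ (2 * a + b) = Q ^+ a * q ^+ b by rewrite exprD exprM.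
  by rewrite qE addnC qE invfM; ring.
rewrite [qpoch _ _ _ * _ / _]mulrAC.
move: (qpoch Q Q (2 * n) / _) (iqpoch Q n r / _) => fac iqr.
by field; rewrite !expf_neq0.
Qed.

(** With [D = n - r > 0], index [r] of the first sum carries [z ^- D] and index [r.+1] of the second
    [z ^+ D], with the same power of [q]; index [n] of the first sum is the term [D = 0]. *)
Lemma rhs_termE m n : rhs_term q z m.+2 n =
  \sum_(0 <= r < n.+1) mate_coef m r * ptheta_term Q z r (n - r).
Proof.
have qE a b : q ^+ (a + 2 * b) = q ^+ a * Q ^+ b by rewrite exprD exprM.
have pw r : (r <= n)%N -> (n ^ 2 + n - 'C(r.+1, 2) + (4 * m + 4) * 'C(r.+1, 2)
    = (4 * m + 3) * 'C(r.+1, 2) + 2 * 'C(n.+1, 2))%N.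
  move=> rn; have := bin2_double n; have := bin2_double r; nia.
(* In both sums the quantity to be halved is twice [n ^ 2 + n - 'C(r.+1, 2)], so the division is
   exact. *)
have e1 r : (r <= n)%N -> (((2 * n ^ 2 - r ^ 2) + (2 * n - r)) %/ 2
    + 2 * (m.+2 - 1) * (r ^ 2 + r) = (4 * m + 3) * 'C(r.+1, 2) + 2 * 'C(n.+1, 2))%N.
  move=> rn; rewrite -pw //.
  have -> : (2 * n ^ 2 - r ^ 2 + (2 * n - r) = (n ^ 2 + n - 'C(r.+1, 2)) * 2)%N.
    by have := bin2_double n; have := bin2_double r; nia.
  by rewrite mulnK //; have := bin2_double r; nia.
have e2 r : (r < n)%N -> (((2 * n ^ 2 - r.+1 ^ 2) + (2 * n + r.+1)) %/ 2
    + 2 * (m.+2 - 1) * (r.+1 ^ 2 - r.+1) =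
    (4 * m + 3) * 'C(r.+1, 2) + 2 * 'C(n.+1, 2))%N.
  move=> rn; rewrite -(pw _ (ltnW rn)).
  have -> : (2 * n ^ 2 - r.+1 ^ 2 + (2 * n + r.+1) = (n ^ 2 + n - 'C(r.+1, 2)) * 2)%N.
    by have := bin2_double n; have := bin2_double r; nia.
  by rewrite mulnK //; have := bin2_double r; nia.
rewrite /rhs_term big_add1 /= big_nat_recr //= [in RHS]big_nat_recr //=.
rewrite addrAC -big_split /=; congr (_ + _).
  apply: eq_big_nat => r /andP[_ rn]; rewrite (e1 _ (ltnW rn)) (e2 _ rn).
  rewrite /mate_coef /ptheta_term; case E : (n - r)%N => [|D]; first by lia.
  have nE : n = (r + D.+1)%N by lia.
  have -> : (r%:Z - n%:Z) = - (D.+1)%:Z by lia.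
  have -> : (n%:Z - r.+1%:Z + 1) = (D.+1)%:Z by lia.
  rewrite nE qE [(-1) ^+ (_ + _)]exprD -exprnN exprVn.
  by rewrite -exprnP; ring.
rewrite subnn subrr expr0z mulr1 e1 // /mate_coef qE mulrA //.
Qed.

End Terms.

(** This supplies the geometric domination in [r] for [tannery] on both sides. *)
Lemma cabs_mate_coef (R : realType) (q : Cx R) m r :
  cabs q < 1 -> cabs (mate_coef q m r) <= cabs q ^+ r.
Proof.
move=> q1; rewrite /mate_coef cabsM !cabsX cabsN cabs1 expr1n mul1r.
rewrite ler_wiXn2l ?cabs_ge0 ?(ltW q1) //.
by rewrite (leq_trans _ (leq_pmull _ _)) ?addn3 // binS bin1 leq_addl.
Qed.

Section PartialSums.
Variable R : realType.
Local Notation C := (Cx R).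
Variables (q z : C) (m : nat).
Local Notation Q := (q ^+ 2).
Hypothesis q_neq0 : q != 0.
Hypothesis q_aper : forall n, 1 - q ^+ n.+1 != 0.
Hypothesis z_neq0 : z != 0.

(** As [conj_term Q z n r = 0] for [n < r], the inner sum may run over all [n < N] after the
    exchange. *)
Lemma series_lhs_term N : series (lhs_term q z m.+2) N =
  \sum_(0 <= r < N) mate_coef q m r * series (conj_term Q z ^~ r) N.
Proof.
elim: N => [|N IH]; first by rewrite seriesEnat /= !big_geq.
rewrite seriesSr IH lhs_termE // [RHS]big_nat_recr //= [in LHS]big_nat_recr //=.
rewrite addrA -big_split /=; congr (_ + _ * _).
  by apply: eq_bigr => r _; rewrite seriesSr mulrDr.
rewrite seriesSr seriesEnat /= big_nat big1 ?add0r // => n /andP[_ nN].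
by rewrite /conj_term iqpoch_eq0 // mul0r !mulr0.
Qed.

(** With [D = n - r], the triangle [r <= n < N] becomes [D < N - r]. *)
Lemma series_rhs_term N : series (rhs_term q z m.+2) N =
  \sum_(0 <= r < N) mate_coef q m r * series (ptheta_term Q z r) (N - r)%N.
Proof.
elim: N => [|N IH]; first by rewrite seriesEnat /= !big_geq.
rewrite seriesSr IH rhs_termE // [RHS]big_nat_recr //= [in LHS]big_nat_recr //=.
rewrite addrA -big_split /=; congr (_ + _ * _).
  by apply: eq_big_nat => r /andP[_ rN]; rewrite subSn ?(ltnW rN) // seriesSr mulrDr.
by rewrite subSn // subnn seriesSr seriesEnat /= big_geq // add0r.
Qed.

End PartialSums.

(* Both series are asserted to converge, since limn is a total operator. *)
Theorem theorem1p5 (R : realType) (q z : Cx R) (k : nat)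
    (hq0 : 0 < `|q|) (hq1 : `|q| < 1) (hz0 : z != 0)
    (hz : forall m : int, m != 0 -> z != q ^ (2 * m))
    (hk : (2 <= k)%N) :
  [/\ cvgn (series (lhs_term q z k)),
      cvgn (series (rhs_term q z k)) &
      qpoch_inf (z * q ^+ 2) (q ^+ 2) * qpoch_inf (z^-1 * q ^+ 2) (q ^+ 2)
        * qpoch_inf (q ^+ 2) (q ^+ 2)
        * limn (series (lhs_term q z k))
      = limn (series (rhs_term q z k))].
Proof.
case: k hk => [|[|m]] // _.
have q0 : q != 0 by rewrite -normr_gt0.
have q1 : cabs q < 1 by rewrite -ltcR -cabsE.
have q01 : 0 <= cabs q < 1 by rewrite cabs_ge0.
have q_aper := expr_aper q1.
pose Q := q ^+ 2; have Q0 : Q != 0 by rewrite expf_neq0.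
have Q1 : cabs Q < 1 by rewrite cabsX exprn_ilt1 ?cabs_ge0.
have Q01 : 0 <= cabs Q < 1 by rewrite cabs_ge0.
have QE (n : nat) : Q ^+ n = q ^ (2 * n%:Z) by rewrite -exprM -exprnP.
(* A zero here would make [z] the excluded power of [q] with [m = - i.+1], and in [zVQ] the one with
   [m = i.+1]. *)
have zQ i : 1 - z * Q ^+ i.+1 != 0.
  rewrite subr_eq0 eq_sym; apply: contraNneq (hz (- i.+1%:Z) isT) => zE.
  by rewrite mulrN -invr_expz -QE -[X in X == _](mulfK (expf_neq0 i.+1 Q0)) zE mul1r.
have zVQ i : 1 - z^-1 * Q ^+ i.+1 != 0.
  rewrite subr_eq0 eq_sym; apply: contraNneq (hz i.+1 isT) => zE.
  by rewrite -QE -[X in _ == X](mulVKf hz0) zE mulr1.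
have [B B0 hB] := conj_term_bounded Q1 zQ zVQ.
have [B' B'0 hB'] := ptheta_term_bounded z Q1.
pose th := theta Q z; have th0 : th != 0 := theta_neq0 Q1 zQ zVQ.
(* By [theta_conj_sum], [tannery] yields this limit both for the right-hand series and for [th]
   times the left-hand one. *)
pose l := limn (series (fun r => mate_coef q m r * ptheta Q z r)).
have rhs_cvg : series (rhs_term q z m.+2) @ \oo --> l.
  rewrite (_ : series _ = fun N => \sum_(0 <= r < N)
      mate_coef q m r * series (ptheta_term Q z r) (N - r)%N); last first.
    by apply/funext => N; rewrite series_rhs_term.
  apply: (@tannery _ _ _ (B' / (1 - cabs Q)) (cabs q)) => // [N r|r].
    rewrite cabsM mulrC ler_pM ?cabs_ge0 //; last exact: cabs_mate_coef.
    apply: (series_geo_bounded Q01) => n; apply: le_trans (hB' _ _) _.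
    by rewrite ler_wpM2r ?exprn_ge0 ?cabs_ge0 // ler_piMr // exprn_ile1 ?cabs_ge0 ?(ltW Q1).
  suff h : (fun N => series (ptheta_term Q z r) (N - r)%N) @ \oo --> ptheta Q z r.
    exact: (cvgM (cvg_cst (mate_coef q m r)) h).
  rewrite -(cvg_shiftn r).
  rewrite (_ : (fun n => _) = series (ptheta_term Q z r)); first exact: ptheta_cvg.
  by apply/funext => n; rewrite /= addnK.
have lhs_cvg : series (lhs_term q z m.+2) @ \oo --> th^-1 * l.
  rewrite (_ : series _ = fun N => th^-1 * \sum_(0 <= r < N)
      (mate_coef q m r * (th * series (conj_term Q z ^~ r) N))); last first.
    apply/funext => N; rewrite series_lhs_term // big_distrr /=.
    by apply: eq_bigr => r _; rewrite mulrCA mulKf.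
  suff h : (fun N => \sum_(0 <= r < N)
      (mate_coef q m r * (th * series (conj_term Q z ^~ r) N))) @ \oo --> l.
    exact: (cvgM (cvg_cst th^-1) h).
  apply: (tannery (K := cabs th * (B / (1 - cabs Q))) q01) => [N r|r].
    rewrite cabsM mulrC ler_pM ?cabs_ge0 //; last exact: cabs_mate_coef.
    rewrite cabsM ler_wpM2l ?cabs_ge0 //.
    apply: (series_geo_bounded Q01) => n; apply: le_trans (hB _ _) _.
    by rewrite ler_wpM2r ?exprn_ge0 ?cabs_ge0 // ler_piMr // exprn_ile1 ?cabs_ge0 ?(ltW Q1).
  rewrite -(theta_conj_sum Q0 Q1 hz0 zQ zVQ).
  exact: (cvgM (cvg_cst (mate_coef q m r))
    (cvgM (cvg_cst th) (@conj_sum_cvg _ _ _ Q1 zQ zVQ r))).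
have rhs_lim : limn (series (rhs_term q z m.+2)) = l.
  by apply: cvg_lim rhs_cvg; exact: norm_hausdorff.
have lhs_lim : limn (series (lhs_term q z m.+2)) = th^-1 * l.
  by apply: cvg_lim lhs_cvg; exact: norm_hausdorff.
split.
- apply/cvg_ex; exists (th^-1 * l); exact: lhs_cvg.
- apply/cvg_ex; exists l; exact: rhs_cvg.
- rewrite rhs_lim lhs_lim; exact: mulVKf.
Qed.
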